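(* For every $r\in\mathbb{N}$ and every integer $n\ge 2$, there is an entrywise nonnegative $3rn\times 3rn$ real matrix $M$ with $\mathrm{rank}^+(M)\ge 4r$ such that for every set of fewer than $n$ rows of $M$, the submatrix of $M$ consisting of those rows has nonnegative rank at most $3r$.
   Context: For an entrywise nonnegative matrix $N$ of dimension $a\times b$, its nonnegative rank $\mathrm{rank}^+(N)$ is the smallest $k$ such that $N=AW$ with $A$ an entrywise nonnegative $a\times k$ matrix and $W$ an entrywise nonnegative $k\times b$ matrix. *)

(* Defs.v *)
From mathcomp Require Import all_boot all_order all_algebra.
From mathcomp Require Import Rstruct.
From Stdlib Require Import Reals.
Set Implicit Arguments. Unset Strict Implicit. Unset Printing Implicit Defensive.
Import Order.TTheory GRing.Theory Num.Theory.
Local Open Scope ring_scope.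

Definition nonneg_mx (m n : nat) (A : 'M[R]_(m, n)) : Prop :=
  forall i j, 0 <= A i j.

Definition nnfact (a b : nat) (N : 'M[R]_(a, b)) (k : nat) : Prop :=
  exists (A : 'M[R]_(a, k)) (W : 'M[R]_(k, b)),
    nonneg_mx A /\ nonneg_mx W /\ N = A *m W.

Lemma nnfact_exists (a b : nat) (N : 'M[R]_(a, b)) :
  nonneg_mx N -> exists k, nnfact N k.
Proof.
move=> HN; exists b; exists N, 1%:M; split => //; split; last by rewrite mulmx1.
by move=> i j; rewrite mxE; case: (i == j).
Qed.

Definition nnrank (a b : nat) (N : 'M[R]_(a, b)) (k : nat) : Prop :=
  nnfact N k /\ (forall k', nnfact N k' -> leq k k').

Definition rows_submx (m n : nat) (M : 'M[R]_(m, n)) (S : {set 'I_m}) :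
  'M[R]_(#|S|, n) := rowsub (fun i : 'I_#|S| => enum_val i) M.

(* Main.v *)
(** A nonnegative matrix of rank 3 whose rows are points of a convex polygon, written in
  slack coordinates, has nonnegative rank at most 3 iff some triangle inside the polygon
  contains all the points.  The polygon is the unit square: a point is [(x, y, z, w)] with
  [x + z = y + w], up to scaling, the coordinates being the distances to the left,
  bottom, right and top sides.

  Pushing vertices outwards, the triangle may be assumed to have its vertices on three
  different sides.  Three points near the midpoints of the left, bottom and right sides
  force these to be the left, bottom and right sides, and the two points [(1, 1, 1)] and
  [(3, 1, 1)] leave, essentially, a one-parameter family of triangles [T(U)] with vertices
  [(0, 2, U + 3)], [(2U, 0, U + 1)] and [(U + 3, U + 1, 0)].  The edge form through the
  first two vertices takes at [(x, y, z)] the value [y U^2 + (x + 3 y - 2 z) U + x], so the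
  point [(2AB, 2, AB + A + B + 3)] is outside [T(U)] exactly for [A < U < B].  For an
  increasing sequence [u_0 < ... < u_(n+1)] the [n] intervals [(u_i, u_(i+2))] cover
  [(u_0, u_(n+1))], but [u_(c+1)] belongs only to the [c]-th one: no triangle contains the
  [n] corresponding points, but one does as soon as one of them is dropped.

  A block diagonal sum of [r] copies multiplies the nonnegative rank by [r], and fewer
  than [n] rows miss one of the [n] points in all the copies at once.  For [n = 2] there is
  no room for the five auxiliary points, and the identity matrix works. *)

Require Import Defs.
From mathcomp Require Import all_boot all_order all_fingroup all_algebra.
From mathcomp Require Import Rstruct.
From Stdlib Require Import Reals.
From mathcomp Require Import ring lra zify.
Set Implicit Arguments. Unset Strict Implicit. Unset Printing Implicit Defensive.
Import Order.TTheory GRing.Theory Num.Theory.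
Local Open Scope ring_scope.

(** * Nonnegative factorizations *)

Definition in_cone k b (W : 'M[R]_(k, b)) (v : 'rV[R]_b) : Prop :=
  exists2 u : 'rV[R]_k, nonneg_mx u & v = u *m W.

Lemma mulmx_ge0 a k b (A : 'M[R]_(a, k)) (W : 'M[R]_(k, b)) :
  nonneg_mx A -> nonneg_mx W -> nonneg_mx (A *m W).
Proof. by move=> A0 W0 i j; rewrite mxE sumr_ge0 // => l _; rewrite mulr_ge0. Qed.

Lemma scalar_mx1_ge0 m : nonneg_mx (1%:M : 'M[R]_m).
Proof. by move=> i j; rewrite mxE; case: eqP. Qed.

Lemma nnfact_in_cone k a b (N : 'M[R]_(a, b)) (W : 'M[R]_(k, b)) :
  nonneg_mx W -> (forall i, in_cone W (row i N)) -> nnfact N k.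
Proof.
move=> W0 NW; have {NW} /fin_all_exists[u uW] : forall i, exists u : 'rV[R]_k,
    nonneg_mx u /\ row i N = u *m W by move=> i; have [u ? ?] := NW i; exists u.
exists (\matrix_i u i), W; split; last split=> //.
  by move=> i j; rewrite mxE; case: (uW i).
by apply/row_matrixP => i; rewrite row_mul rowK; case: (uW i).
Qed.

Lemma nnfact_in (T : finType) (P : {pred T}) a b (N : 'M[R]_(a, b))
    (A : 'I_a -> T -> R) (W : T -> 'I_b -> R) :
  (forall i t, 0 <= A i t) -> (forall t j, 0 <= W t j) ->
  (forall i j, N i j = \sum_(t in P) A i t * W t j) -> nnfact N #|P|.
Proof.
move=> A0 W0 NE.
exists (\matrix_(i, k) A i (enum_val k)), (\matrix_(k, j) W (enum_val k) j).
split; first by move=> i k; rewrite mxE.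
split; first by move=> k j; rewrite mxE.
apply/matrixP=> i j; rewrite NE mxE big_enum_val.
by apply: eq_bigr => k _; rewrite !mxE.
Qed.

Lemma nnfact_nrows a b (N : 'M[R]_(a, b)) : nonneg_mx N -> nnfact N a.
Proof.
by move=> N0; exists 1%:M, N; rewrite mul1mx; split=> //; apply: scalar_mx1_ge0.
Qed.

Lemma mxrank_le_nnfact a b (N : 'M[R]_(a, b)) k : nnfact N k -> (\rank N <= k)%nat.
Proof.
move=> [A [W [_ [_ ->]]]].
exact: leq_trans (mxrankM_maxr _ _) (rank_leq_row _).
Qed.

Definition mxsupp q b (W : 'M[R]_(q, b)) : {set 'I_q * 'I_b} :=
  [set ij | W ij.1 ij.2 != 0].

Lemma max_scale_le (F : realFieldType) (J : finType) (u v : J -> F) j0 :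
  (forall j, 0 <= u j) -> (forall j, 0 <= v j) -> v j0 != 0 ->
  exists2 t, 0 <= t & (forall j, t * v j <= u j) /\
                      (exists2 j, v j != 0 & u j = t * v j).
Proof.
move=> u0 v0 vj0.
have [j vj min_j] := @arg_minP _ _ _ j0 (fun j => v j != 0) (fun j => u j / v j) vj0.
exists (u j / v j); first by rewrite divr_ge0.
split; last by exists j; rewrite // divfK.
move=> i; have [->|vi] := eqVneq (v i) 0; first by rewrite mulr0.
by rewrite -ler_pdivlMr ?min_j // lt_def vi v0.
Qed.

(* Geometrically, the vertex [k] is pushed away from the vertex [l] until it hits
   a new side of the outer polytope. *)
Lemma nnfact_push a b q (A : 'M[R]_(a, q)) (W : 'M[R]_(q, b)) k l :
  nonneg_mx A -> nonneg_mx W -> k != l -> row l W != 0 ->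
  (forall j, W l j != 0 -> W k j != 0) ->
  exists (A' : 'M[R]_(a, q)) (W' : 'M[R]_(q, b)),
  [/\ nonneg_mx A', nonneg_mx W', A *m W = A' *m W' & mxsupp W' \proper mxsupp W].
Proof.
move=> A0 W0 kl /rV0Pn[j0]; rewrite mxE => Wlj0 supp_lk.
have [t t0 [tW [j1 Wlj1 tWj1]]] := max_scale_le (W0 k) (W0 l) Wlj0.
pose E : 'M[R]_q := t *: delta_mx k l.
have EW i j : (E *m W) i j = if i == k then t * W l j else 0.
  rewrite -scalemxAl mxE -(mul_delta_mx (ord0 : 'I_1)) -mulmxA -rowE mxE big_ord1 !mxE andbT.
  by case: eqP => _ /=; rewrite ?mul1r ?mul0r ?mulr0.
have AE i j : (A *m E) i j = if j == l then t * A i k else 0.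
  rewrite -scalemxAr mxE -(mul_delta_mx (ord0 : 'I_1)) mulmxA -colE mxE big_ord1 !mxE eqxx.
  by case: eqP => _ /=; rewrite ?mulr1 ?mulr0.
have W'E i j : ((1%:M - E) *m W) i j = W i j - if i == k then t * W l j else 0.
  by rewrite mulmxBl mul1mx mxE [X in _ + X]mxE EW.
exists (A *m (1%:M + E)), ((1%:M - E) *m W); split.
- move=> i j; rewrite mulmxDr mulmx1 mxE AE addr_ge0 //.
  by case: (j =P l) => // _; rewrite mulr_ge0.
- by move=> i j; rewrite W'E; case: eqP => [->|_]; rewrite subr_ge0.
- have EE : E *m E = 0.
    by rewrite -scalemxAl -scalemxAr mul_delta_mx_0 ?scaler0 // eq_sym.
  by rewrite mulmxA -(mulmxA A) mulmxDl !mulmxBr EE !mulmx1 mul1mx subr0 subrK mulmx1.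
apply/properP; split.
  apply/subsetP=> -[i j]; rewrite !inE /= W'E; case: (i =P k) => [->|_]; last by rewrite subr0.
  by have [Wlj|/supp_lk //] := eqVneq (W l j) 0; rewrite Wlj mulr0 subr0.
by exists (k, j1); rewrite !inE /= ?supp_lk // W'E eqxx tWj1 subrr eqxx.
Qed.

Lemma row_free_rank_mulmx (F : fieldType) a b q (A : 'M[F]_(a, q)) (W : 'M[F]_(q, b)) :
  \rank (A *m W) = q -> row_free W.
Proof.
by move=> rAW; rewrite /row_free eqn_leq rank_leq_row -[leqLHS]rAW mxrankM_maxr.
Qed.

Lemma submx_rank_mulmx (F : fieldType) a b q (A : 'M[F]_(a, q)) (W : 'M[F]_(q, b)) :
  \rank (A *m W) = q -> (W <= A *m W)%MS.
Proof.
move=> rAW; have /eqP Wq := row_free_rank_mulmx rAW.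
by rewrite -(mxrank_leqif_sup (submxMl A W)) rAW Wq.
Qed.

Lemma nnfact_antichain a b q (N : 'M[R]_(a, b)) : \rank N = q -> nnfact N q ->
  exists (A : 'M[R]_(a, q)) (W : 'M[R]_(q, b)),
  [/\ nonneg_mx A, nonneg_mx W, N = A *m W
    & forall k l, k != l -> exists2 j, W k j = 0 & W l j != 0].
Proof.
move=> rN [A [W [A0 [W0 NAW]]]].
have [m] := ubnP #|mxsupp W|; elim: m => // m IH in A W A0 W0 NAW * => lt_m.
have [/forallP anti|] := boolP [forall k, forall l, (k != l) ==>
                          [exists j, (W k j == 0) && (W l j != 0)]].
  exists A, W; split=> // k l kl.
  by have /forallP/(_ l)/implyP/(_ kl)/existsP[j /andP[/eqP ? ?]] := anti k; exists j.
move=> /forallPn[k /forallPn[l]]; rewrite negb_imply => /andP[kl /existsPn supp].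
have Wfree : row_free W by apply: (row_free_rank_mulmx (A := A)); rewrite -NAW.
have Wl0 : row l W != 0.
  by apply: contraTneq Wfree => Wl; apply/row_freePn; exists l; rewrite Wl sub0mx.
have [|A' [W' [A'0 W'0 eAW ltW]]] := nnfact_push A0 W0 kl Wl0.
  by move=> j Wlj; have := supp j; rewrite Wlj andbT.
apply: (IH A' W') => //; first by rewrite NAW.
exact: leq_trans (proper_card ltW) _.
Qed.

Lemma in_cone_colsub k b b' (f : 'I_b' -> 'I_b) (W : 'M[R]_(k, b)) v :
  in_cone W v -> in_cone (colsub f W) (colsub f v).
Proof. by move=> [u u0 ->]; exists u; rewrite // mulmx_colsub. Qed.

Lemma in_cone_row_perm q b (g : 'S_q) (W : 'M[R]_(q, b)) v :
  in_cone W v -> in_cone (row_perm g W) v.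
Proof.
move=> [u u0 ->]; exists (col_perm g u); first by move=> i j; rewrite mxE.
by rewrite mul_col_perm; congr (_ *m _); apply/matrixP => i j; rewrite !mxE permKV.
Qed.

(* For three sets no general Hall theorem is needed: pick [f k] in [Z k] outside [Z (k + 1)]. *)
Lemma antichain3_sdr (T : finType) (Z : 'I_3 -> pred T) :
  (forall k l, k != l -> exists2 j, Z k j & ~~ Z l j) ->
  exists2 f : 'I_3 -> T, injective f & forall k, Z k (f k).
Proof.
move=> anti; have /fin_all_exists2[f Zf Zf'] k : exists2 j, Z k j & ~~ Z (k + 1) j.
  by apply: anti; case: k => [[|[|[|k]]]].
have f_succ k : f k != f (k + 1) by apply: contraNneq (Zf' k) => ->.
exists f => // k l fkl; apply/eqP/contraT => kl.
have [lE|kE] : l = k + 1 \/ k = l + 1.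
- move: kl {fkl}; case: k l => [[|[|[|k]]] ?] [[|[|[|l]]] ?] // _;
    by [left; apply: val_inj | right; apply: val_inj].
- by have := f_succ k; rewrite -lE fkl eqxx.
- by have := f_succ l; rewrite -kE fkl eqxx.
Qed.

Lemma inj_ord3_cyclic (f : 'I_3 -> 'I_4) : injective f ->
  exists s : 'I_4, exists g : 'S_3, forall k : 'I_3, f (g k) = s + k%:R.
Proof.
move=> f_inj; have [t ft] : exists t, t \notin codom f.
  apply/existsP; rewrite -negb_forall; apply/negP => /forallP f_surj.
  have := subset_leq_card (introT subsetP (fun t _ => f_surj t) : {: 'I_4} \subset codom f).
  by rewrite card_codom // !card_ord.
have codom_f : codom f =i predC1 t.
  apply/subset_cardP; first by rewrite card_codom // cardC1 !card_ord.
  by apply/subsetP => j; apply: contraTneq => ->.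
have natr_inj : injective (fun k : 'I_3 => k%:R : 'I_4).
  move=> k l /(congr1 val).
  by rewrite !Zp_nat /= !modn_small ?(ltn_trans (ltn_ord _)) // => /val_inj.
have /fin_all_exists[g fg] (k : 'I_3) : exists l, f l = t + 1 + k%:R.
  have /codomP[l ->] : t + 1 + k%:R \in codom f; last by exists l.
  rewrite codom_f inE -subr_eq0 addrAC [t + 1]addrC addrK.
  by case: k => [[|[|[|k]]]].
have g_inj : injective g.
  by move=> k l gkl; apply/natr_inj/(addrI (t + 1)); rewrite -!fg gkl.
by exists (t + 1), (perm g_inj) => k; rewrite permE.
Qed.

Lemma sum_ord3 (V : nmodType) (f : 'I_3 -> V) : \sum_k f k = f 0 + f 1 + f 2.
Proof.
rewrite !big_ord_recl big_ord0 addr0 addrA.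
by congr (f _ + f _ + f _); apply: val_inj.
Qed.

(** * Block diagonal matrices *)

Section BlockDiagonal.
Variables (r a c m p : nat) (N : 'M[R]_(a, c)).
Variables (rblock : 'I_m -> 'I_r * 'I_a) (cblock : 'I_p -> 'I_r * 'I_c).

Definition block_diag : 'M[R]_(m, p) :=
  \matrix_(i, j) if (rblock i).1 == (cblock j).1
                 then N (rblock i).2 (cblock j).2 else 0.

Lemma block_diag_ge0 : nonneg_mx N -> nonneg_mx block_diag.
Proof. by move=> N0 i j; rewrite mxE; case: ifP. Qed.

(* A rank-one nonnegative term meeting one diagonal block cannot meet another one,
   as the off-diagonal entries vanish. *)
Lemma nnfact_block_diag_geq rblock' cblock' d k :
  cancel rblock' rblock -> cancel cblock' cblock ->
  (forall k', nnfact N k' -> (d <= k')%nat) ->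
  nnfact block_diag k -> (d * r <= k)%nat.
Proof.
move=> rK cK Nd [A [W [A0 [W0 NAW]]]].
have AW b b' i j : \sum_l A (rblock' (b, i)) l * W l (cblock' (b', j))
                   = if b == b' then N i j else 0.
  by have /matrixP/(_ (rblock' (b, i)) (cblock' (b', j))) := NAW; rewrite !mxE rK cK.
pose S b := [set l | [exists i, A (rblock' (b, i)) l != 0]
                     && [exists j, W l (cblock' (b, j)) != 0]].
have dS b : (d <= #|S b|)%nat.
  apply: Nd; apply: (nnfact_in (A := fun i l => A (rblock' (b, i)) l)
                       (W := fun l j => W l (cblock' (b, j)))) => // i j.
  have := AW b b i j; rewrite eqxx => <-; rewrite [RHS]big_mkcond /=.
  apply: eq_bigr => l _; rewrite inE; case: ifP => // /negbT.
  rewrite negb_and !negb_exists => /orP[] /forallP.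
    by move=> /(_ i); rewrite negbK => /eqP->; rewrite mul0r.
  by move=> /(_ j); rewrite negbK => /eqP->; rewrite mulr0.
have disjS b b' : b != b' -> [disjoint S b & S b'].
  move=> /negPf nbb; rewrite -setI_eq0; apply/eqP/setP => l; rewrite !inE.
  apply/negP => /andP[/andP[/existsP[i Ai] _] /andP[_ /existsP[j Wj]]].
  have /eqP := AW b b' i j; rewrite nbb psumr_eq0 => [|t _]; last exact: mulr_ge0.
  move=> /allP/(_ l); rewrite mem_index_enum mulf_eq0 (negPf Ai) (negPf Wj).
  by move=> /(_ isT).
have sumS : #|\bigcup_b S b| = (\sum_b #|S b|)%nat.
  rewrite -sum1_card (partition_disjoint_bigcup _ _ disjS).
  by apply: eq_bigr => b _; rewrite sum1_card.
rewrite mulnC -[r in (r * d)%nat]card_ord -sum_nat_const -[k]card_ord.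
by apply: leq_trans (max_card (\bigcup_b S b)); rewrite sumS leq_sum.
Qed.

Lemma nnfact_rows_block_diag (S : {set 'I_m}) (I : {set 'I_a}) q :
  (forall i, i \in S -> (rblock i).2 \in I) ->
  nnfact (rows_submx N I) q -> nnfact (rows_submx block_diag S) (q * r).
Proof.
move=> SI [A [W [A0 [W0 NAW]]]].
have -> : (q * r)%nat = #|{: 'I_r * 'I_q}| by rewrite card_prod !card_ord mulnC.
pose rowI (i : 'I_#|S|) := enum_rank_in (SI _ (enum_valP i)) (rblock (enum_val i)).2.
apply: (nnfact_in
  (A := fun i t => if (rblock (enum_val i)).1 == t.1 then A (rowI i) t.2 else 0)
  (W := fun t j => if t.1 == (cblock j).1 then W t.2 (cblock j).2 else 0)).
- by move=> i t; case: ifP.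
- by move=> t j; case: ifP.
move=> i j; rewrite !mxE -(pair_bigA _ (fun b l =>
  (if (rblock (enum_val i)).1 == b then A (rowI i) l else 0) *
  (if b == (cblock j).1 then W l (cblock j).2 else 0))) /=.
rewrite (bigD1 (rblock (enum_val i)).1) //= [X in _ + X]big1 => [|b nb]; last first.
  by rewrite big1 // => l _; rewrite eq_sym (negPf nb) mul0r.
rewrite addr0 eqxx; case: ifP => _; last by rewrite big1 // => l _; rewrite mulr0.
have /matrixP/(_ (rowI i) (cblock j).2) := NAW; rewrite !mxE => <-.
by rewrite enum_rankK_in // SI // enum_valP.
Qed.

End BlockDiagonal.

(** * Triangles inscribed in the square *)

Section TrianglesInSquare.
Variable F : realFieldType.
Implicit Types a b c x y z U A B : F.

(* [(x, y, z)] lies in the triangle with vertices [(0, a, 1)], [(b, 0, 1 - b)] and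
   [(1, c, 0)]: the three edge forms are nonnegative at it. *)
Definition in_tri a b c x y z : Prop :=
  [/\ 0 <= y * (1 - b) - c * (x * (1 - b) - b * z),
      0 <= a * z + c * x - y
    & 0 <= a * x + b * y - a * b * (x + z)].

Lemma factor_in_itv01 (u w : F) : 0 <= u <= w ->
  exists2 a, 0 <= a <= 1 & u = a * w.
Proof.
move=> /andP[u0 uw]; have [w0|wn0] := eqVneq w 0.
  by exists 0; rewrite ?lexx ?ler01 // mul0r; apply: le_anti; rewrite u0 -w0 uw.
have wp : 0 < w by rewrite lt_def wn0 (le_trans u0).
by exists (u / w); rewrite ?divfK // divr_ge0 ?ler_pdivrMr ?mul1r //= ltW.
Qed.

Lemma in_tri_cone (a b c l m k : F) :
  0 <= a <= 1 -> 0 <= b <= 1 -> 0 <= c <= 1 -> 0 <= l -> 0 <= m -> 0 <= k ->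
  in_tri a b c (m * b + k) (l * a + k * c) (l + m * (1 - b)).
Proof.
move=> a01 b01 c01 l0 m0 k0; have D0 : 0 <= a * (1 - b) + b * c.
  by apply: addr_ge0; apply: mulr_ge0; lra.
have lD := mulr_ge0 l0 D0; have mD := mulr_ge0 m0 D0; have kD := mulr_ge0 k0 D0.
by split; lra.
Qed.

Lemma in_tri_mirror a b c x y z : in_tri a b c x y z -> in_tri c (1 - b) a z y x.
Proof. by case=> bc_edge ac_edge ab_edge; split; lra. Qed.

(* In the next four lemmas the points [(2, 9, 18, 11)], [(18, 9, 2, 11)] and
   [(10, 1, 10, 19)], near the left, right and bottom sides, are read with cyclically
   shifted coordinates, so that the missing side becomes the fourth one. *)
Lemma no_tri_missing_right a b c : 0 <= a <= 1 -> 0 <= b <= 1 -> 0 <= c <= 1 ->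
  in_tri a b c 11 2 9 -> in_tri a b c 11 18 9 -> in_tri a b c 19 10 1 -> False.
Proof.
move=> a01 b01 c01 [L1 L2 L3] [R1 R2 R3] [B1 B2 B3].
have a_ge : 7/9 <= a by lra.
have c_ge : 9/11 <= c by lra.
have b_le : b <= 7/10 by nra.
have b_ge : 8/10 <= b by nra.
by lra.
Qed.

Lemma no_tri_missing_left a b c : 0 <= a <= 1 -> 0 <= b <= 1 -> 0 <= c <= 1 ->
  in_tri a b c 9 18 11 -> in_tri a b c 9 2 11 -> in_tri a b c 1 10 19 -> False.
Proof.
move=> a01 b01 c01 /in_tri_mirror TL /in_tri_mirror TR /in_tri_mirror TB.
by apply: no_tri_missing_right TR TL TB => //; lra.
Qed.

Lemma no_tri_missing_bottom a b c : 0 <= a <= 1 -> 0 <= b <= 1 -> 0 <= c <= 1 ->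
  in_tri a b c 18 11 2 -> in_tri a b c 2 11 18 -> in_tri a b c 10 19 10 -> False.
Proof.
move=> a01 b01 c01 [L1 L2 L3] [R1 R2 R3] [B1 B2 B3].
have a_ge : 9/10 <= a by lra.
have c_ge : 9/10 <= c by lra.
have b_le : b <= 3/10 by nra.
have b_ge : 7/10 <= b by nra.
by lra.
Qed.

Lemma tri_missing_top_bounds a b c : 0 <= a <= 1 -> 0 <= b <= 1 -> 0 <= c <= 1 ->
  in_tri a b c 2 9 18 -> in_tri a b c 18 9 2 -> in_tri a b c 10 1 10 ->
  7/18 <= a < 8/13 /\ b < 3/4.
Proof.
move=> a01 b01 c01 [L1 L2 L3] [R1 R2 R3] [B1 B2 B3].
have a_ge : 7/18 <= a by lra.
have c_ge : 7/18 <= c by lra.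
have b_lt : b < 3/4 by nra.
have b_ge : 2/5 <= b by nra.
by split=> //; apply/andP; split=> //; nra.
Qed.

(* [(1, 1, 1)] forces [c >= 1 - a] and then [(3, 1, 1)] forces [b] to be at least its
   value in the family [T(U)]. *)
Lemma tri_base_ge a b c U : 0 < U + 3 -> a * (U + 3) = 2 -> b < 3/4 ->
  in_tri a b c 1 1 1 -> in_tri a b c 3 1 1 -> 2 * U <= b * (3 * U + 1).
Proof.
move=> U3 aU b_lt [_ ac_edge _] [bc_edge _ _].
have cU : U + 1 <= c * (U + 3).
  have -> : U + 1 = (1 - a) * (U + 3) by rewrite mulrBl aU; ring.
  by rewrite ler_wpM2r; lra.
have : (U + 1) * (3 - 4 * b) <= (1 - b) * (U + 3).
  apply: le_trans (_ : c * (U + 3) * (3 - 4 * b) <= _).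
    by rewrite ler_wpM2r //; lra.
  by rewrite mulrAC ler_wpM2r //; lra.
by lra.
Qed.

Lemma tri_outside_interval a b c U A B : 0 < U -> 0 < A -> 0 < B ->
  a * (U + 3) = 2 -> 2 * U <= b * (3 * U + 1) ->
  in_tri a b c (2 * A * B) 2 (A * B + A + B + 3) -> 0 <= (U - A) * (U - B).
Proof.
move=> U0 A0 B0 aU bU [_ _ ab_edge]; have AB0 := mulr_gt0 A0 B0.
pose D := 3 * A * B + A + B - U.
have [D0|D_lt0] := leP 0 D; last by apply: mulr_ge0; rewrite /D in D_lt0; lra.
have bD : 2 * b * D <= 4 * A * B.
  pose X := 2 * A * B - b * (3 * A * B + A + B + 3).
  have aX : a * (U + 3) * X = 2 * X by rewrite aU.
  have U3 : 0 <= U + 3 by lra.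
  by have := mulr_ge0 ab_edge U3; rewrite /X in aX; rewrite /D; lra.
have UD : 2 * U * D <= b * (3 * U + 1) * D by rewrite ler_wpM2r.
have bDU : 2 * b * D * (3 * U + 1) <= 4 * A * B * (3 * U + 1) by rewrite ler_wpM2r //; lra.
by rewrite /D in UD bDU; lra.
Qed.

End TrianglesInSquare.

(* The columns are indexed by [Z/4], in the cyclic order left, bottom, right, top of
   the sides of the square, so that [s + 1] is the side after [s]. *)
Definition in_plane (v : 'rV[R]_4) : Prop := v 0 0 + v 0 2 = v 0 1 + v 0 3.

Lemma in_plane_rot s v : in_plane v -> in_plane (colsub (+%R s) v).
Proof.
rewrite /in_plane !mxE -[s + 0]natr_Zp -[s + 1]natr_Zp -[s + 2]natr_Zp -[s + 3]natr_Zp.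
by case: s => [[|[|[|[|s]]]] ?] //= e; lra.
Qed.

Lemma in_plane_submx m k (N : 'M[R]_(m, 4)) (W : 'M[R]_(k, 4)) :
  (forall i, in_plane (row i N)) -> (W <= N)%MS -> forall i, in_plane (row i W).
Proof.
move=> Nplane /submxP[D ->] i; rewrite /in_plane !mxE -!big_split /=.
apply: eq_bigr => j _; have := Nplane j; rewrite /in_plane !mxE => Nj.
by rewrite -!mulrDr Nj.
Qed.

Lemma nnfact3_inscribed m (N : 'M[R]_(m, 4)) : \rank N = 3%nat -> nnfact N 3 ->
  exists (W : 'M[R]_(3, 4)) (s : 'I_4),
  [/\ nonneg_mx W, (W <= N)%MS, forall i, in_cone W (row i N)
    & forall k : 'I_3, W k (s + k%:R) = 0].
Proof.
move=> rN /(nnfact_antichain rN)[A [W [A0 W0 NAW anti]]].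
have [|f f_inj Wf] := @antichain3_sdr _ (fun k j => W k j == 0).
  by move=> k l /anti[j /eqP ? ?]; exists j.
have [s [g fg]] := inj_ord3_cyclic f_inj.
have WN : (W <= A *m W)%MS by apply: submx_rank_mulmx; rewrite -NAW.
exists (row_perm g W), s; split.
- by move=> i j; rewrite mxE.
- by rewrite row_permE NAW (submx_trans (submxMl _ _)).
- move=> i; apply: in_cone_row_perm; exists (row i A); last by rewrite NAW row_mul.
  by move=> k j; rewrite mxE.
- by move=> k; rewrite mxE -fg; apply/eqP/Wf.
Qed.

Lemma inscribed_in_tri (W : 'M[R]_(3, 4)) :
  nonneg_mx W -> (forall k, in_plane (row k W)) -> (forall k : 'I_3, W k k%:R = 0) ->
  exists a b c, [/\ 0 <= a <= 1, 0 <= b <= 1, 0 <= c <= 1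
    & forall v, in_cone W v -> in_tri a b c (v 0 0) (v 0 1) (v 0 2)].
Proof.
move=> W0 Wplane Wk.
have plane k : W k 0 + W k 2 = W k 1 + W k 3 by have := Wplane k; rewrite /in_plane !mxE.
have W00 : W 0 0 = 0 := Wk 0; have W11 : W 1 1 = 0 := Wk 1; have W22 : W 2 2 = 0 := Wk 2.
have [|a a01 Wa] := @factor_in_itv01 _ (W 0 1) (W 0 2).
  by have := plane 0; have := W0 0 1; have := W0 0 3; lra.
have [|b b01 Wb] := @factor_in_itv01 _ (W 1 0) (W 1 3).
  by have := plane 1; have := W0 1 0; have := W0 1 2; lra.
have [|c c01 Wc] := @factor_in_itv01 _ (W 2 1) (W 2 0).
  by have := plane 2; have := W0 2 1; have := W0 2 3; lra.
exists a, b, c; split=> // v [u u0 ->].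
have := in_tri_cone a01 b01 c01 (mulr_ge0 (u0 0 0) (W0 0 2)) (mulr_ge0 (u0 0 1) (W0 1 3))
          (mulr_ge0 (u0 0 2) (W0 2 0)).
have W12 : W 1 2 = (1 - b) * W 1 3 by have := plane 1; lra.
by rewrite !mxE !sum_ord3 W00 W11 W22 Wa Wb Wc W12; congr in_tri; ring.
Qed.

(** * A one-parameter family of triangles *)

Lemma double_steps_cover (F : realDomainType) (u : nat -> F) n (U : F) : (0 < n)%nat ->
  (forall i, (i < n)%nat -> u i < u i.+1) -> u 0%nat < U < u n.+1 ->
  exists2 i, (i < n)%nat & u i < U < u i.+2.
Proof.
move=> n0 u_lt /andP[u0U Uu].
have ex : exists i, (i < n)%nat && (U < u i.+2) by exists n.-1; rewrite ltn_predL n0 prednK.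
case: (ex_minnP ex) => i /andP[lt_in Ui] min_i; exists i; rewrite // Ui andbT.
case: i lt_in min_i {Ui} => [//|i] lt_in min_i.
apply: lt_le_trans (u_lt _ lt_in) _; rewrite leNgt; apply/negP => Ui.
by have := min_i i; rewrite Ui (ltnW lt_in) ltnn => /(_ isT).
Qed.

Lemma double_step_outside (F : realDomainType) (u : nat -> F) i j :
  {homo u : i j / (i <= j)%nat >-> i <= j} -> i != j ->
  0 <= (u j.+1 - u i) * (u j.+1 - u i.+2).
Proof.
move=> u_le; rewrite neq_ltn => /orP[lt_ij|lt_ji].
  by rewrite mulr_ge0 // subr_ge0 u_le //; lia.
by rewrite mulr_le0 // subr_le0 u_le //; lia.
Qed.

Section Nodes.
Variable F : realFieldType.

(* [1/4] and [3] bracket the parameters [2 / a - 3] allowed by [tri_missing_top_bounds]. *)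
Definition node n i : F :=
  if i == 0%nat then 1/4 else if (i <= n)%nat then 1 + i%:R / (10 * n%:R) else 3.

Lemma node_inner n i : (0 < i <= n)%nat -> node n i = 1 + i%:R / (10 * n%:R).
Proof. by move=> /andP[i0 le_in]; rewrite /node le_in; case: i i0 {le_in}. Qed.

Lemma node_inner_bounds n i : (0 < i <= n)%nat -> 1 <= node n i <= 11/10.
Proof.
move=> in_i; rewrite node_inner //; have n0 : 0 < n%:R :> F by rewrite ltr0n; lia.
rewrite lerDl divr_ge0 ?mulr_ge0 ?ler0n //=.
have : i%:R / (10 * n%:R) <= 1/10 :> F.
  rewrite ler_pdivrMr ?mulr_gt0 //; have : i%:R <= n%:R :> F by rewrite ler_nat; lia.
  by lra.
by lra.
Qed.

Lemma node_bounds n i : 1/4 <= node n i <= 3.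
Proof.
rewrite /node; case: i => [|i] /=; first by lra.
case: ifP => [lt_in|_]; last by lra.
by have := @node_inner_bounds n i.+1; rewrite node_inner // => /(_ lt_in); lra.
Qed.

Lemma node_ltS n i : (0 < n)%nat -> (i <= n)%nat -> node n i < node n i.+1.
Proof.
move=> n0 le_in; have [i_n|in_n] := eqVneq i n.
  rewrite i_n [ltRHS]/node ltnn; have := @node_inner_bounds n n; rewrite n0 leqnn => /(_ isT).
  by lra.
case: i le_in in_n => [_ _|i lt_in in_n].
  by have := @node_inner_bounds n 1; rewrite n0 [ltLHS]/node /= => /(_ isT); lra.
rewrite !node_inner //; try lia.
by rewrite ltrD2l ltr_pM2r ?ltr_nat // invr_gt0 mulr_gt0 // ltr0n.
Qed.

Lemma node_le n : (0 < n)%nat -> {homo node n : i j / (i <= j)%nat >-> i <= j}.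
Proof.
move=> n0; apply: homo_leq => [||i]; [exact: lexx | exact: le_trans |].
have [/(node_ltS n0)/ltW //|lt_ni] := leqP i n.
have node_last j : (n < j)%nat -> node n j = 3.
  by case: j => // j lt_nj; rewrite /node /= leqNgt lt_nj.
by rewrite !node_last // (ltn_trans lt_ni).
Qed.

Lemma no_tri_missing_top n (a b c : F) : (0 < n)%nat ->
  0 <= a <= 1 -> 0 <= b <= 1 -> 0 <= c <= 1 ->
  in_tri a b c 1 1 1 -> in_tri a b c 3 1 1 ->
  in_tri a b c 2 9 18 -> in_tri a b c 18 9 2 -> in_tri a b c 10 1 10 ->
  (forall i (A := node n i) (B := node n i.+2), (i < n)%nat ->
     in_tri a b c (2 * A * B) 2 (A * B + A + B + 3)) -> False.
Proof.
move=> n0 a01 b01 c01 T111 T311 TL TR TB Tinterval.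
have [a_bounds b_lt] := tri_missing_top_bounds a01 b01 c01 TL TR TB.
have a0 : 0 < a by lra.
pose U := 2 / a - 3; have aU : a * (U + 3) = 2 by rewrite subrK mulrC divfK // gt_eqF.
have U_bounds : 1/4 < U < 3 by rewrite ltrBrDr ltrBlDr ltr_pdivlMr // ltr_pdivrMr //; lra.
have [|i lt_in /andP[AU UB]] := @double_steps_cover _ (node n) n U n0
    (fun i lt_in => node_ltS n0 (ltnW lt_in)).
  by rewrite /node ltnn.
have bU : 2 * U <= b * (3 * U + 1) by apply: tri_base_ge T111 T311 => //; lra.
have A_bounds := node_bounds n i; have B_bounds := node_bounds n i.+2.
have : 0 <= (U - node n i) * (U - node n i.+2).
  by apply: tri_outside_interval (Tinterval i lt_in) => //; lra.
by rewrite leNgt pmulr_rlt0 ?subr_gt0 // subr_lt0 UB.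
Qed.

End Nodes.

Definition slack (V : zmodType) (x y z : V) : 'rV[V]_4 :=
  \row_j nth 0 [:: x; y; z; x + z - y] j.

Lemma slack_plane (x y z : R) : in_plane (slack x y z).
Proof. by rewrite /in_plane !mxE /=; lra. Qed.

Lemma slack_rot (V : zmodType) (s : 'I_4) (x y z : V) :
  colsub (+%R s) (slack x y z) = \row_j nth 0 (rot s [:: x; y; z; x + z - y]) j.
Proof.
by apply/rowP => j; rewrite !mxE; case: s => [[|[|[|[|s]]]] ?] //;
   case: j => [[|[|[|[|j]]]] ?].
Qed.

Definition tri_vertices (F : realFieldType) (U : F) : 'M[F]_(3, 4) :=
  \matrix_k nth (slack (U + 3) (U + 1) 0) [:: slack 0 2 (U + 3); slack (2 * U) 0 (U + 1)] k.

Lemma tri_vertices_ge0 (U : R) : 1 <= U -> nonneg_mx (tri_vertices U).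
Proof.
move=> U1 k j; rewrite mxE.
by case: k => [[|[|[|k]]] ?] //=; rewrite mxE; case: j => [[|[|[|[|j]]]] ?] //=; lra.
Qed.

(* [e] is the edge form of the first two vertices at [(x, y, z)]; it takes the value
   [(U + 1) ^+ 2 * (U + 3)] at the third one. *)
Lemma in_cone_tri_vertices (U x y z : R)
    (e := y * U ^+ 2 + (x + 3 * y - 2 * z) * U + x) :
  0 < U -> 0 <= e -> e <= y * ((U + 1) * (U + 3)) -> e <= x * (U + 1) ^+ 2 ->
  in_cone (tri_vertices U) (slack x y z).
Proof.
move=> U0 e0 ey ex; have U1 : 0 < U + 1 by lra.
have U3 : 0 < U + 3 by lra.
pose t := e / ((U + 1) ^+ 2 * (U + 3)).
have t0 : 0 <= t by rewrite divr_ge0 // mulr_ge0 ?exprn_ge0 // ltW.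
have yt : 0 <= y - t * (U + 1).
  have -> : t * (U + 1) = e / ((U + 1) * (U + 3)) by rewrite /t; field; rewrite !gt_eqF.
  by rewrite subr_ge0 ler_pdivrMr ?mulr_gt0.
have xt : 0 <= x - t * (U + 3).
  have -> : t * (U + 3) = e / (U + 1) ^+ 2 by rewrite /t; field; rewrite !gt_eqF.
  by rewrite subr_ge0 ler_pdivrMr ?exprn_gt0.
exists (\row_k nth t [:: (y - t * (U + 1)) / 2; (x - t * (U + 3)) / (2 * U)] k).
  have U2 : 0 <= 2 * U by rewrite mulr_ge0 // ltW.
  by move=> i k; rewrite mxE; case: k => [[|[|[|k]]] ?] //=; rewrite divr_ge0.
apply/rowP=> j; rewrite [RHS]mxE sum_ord3 !mxE /= /t /e.
by case: j => [[|[|[|[|j]]]] ?] //=; field; rewrite !gt_eqF.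
Qed.

Definition interval_point (F : realFieldType) (A B : F) :=
  slack (2 * A * B) 2 (A * B + A + B + 3).

Lemma in_cone_interval_point (U A B : R) :
  1 <= U <= 11/10 -> 1/4 <= A <= 3 -> 1 <= B <= 3 ->
  0 <= (U - A) * (U - B) -> in_cone (tri_vertices U) (interval_point A B).
Proof.
move=> U_bounds A_bounds B_bounds UAB; have AB0 : 0 <= A * B by rewrite mulr_ge0 //; lra.
have eE : 2 * U ^+ 2 + (2 * A * B + 3 * 2 - 2 * (A * B + A + B + 3)) * U + 2 * A * B
  = 2 * ((U - A) * (U - B)) by ring.
apply: in_cone_tri_vertices; rewrite ?eE; [by lra | by rewrite mulr_ge0 | by nra |].
have : 0 <= U * (A * B * (U + 2) + (A + B - U)).
  by apply: mulr_ge0; [lra | apply: addr_ge0; [apply: mulr_ge0 => // |]; lra].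
by lra.
Qed.

(* All the indices from 4 on give the point [(10, 1, 10)]. *)
Definition aux_point (F : realFieldType) k : 'rV[F]_4 :=
  nth (slack 10 1 10) [:: slack 1 1 1; slack 3 1 1; slack 2 9 18; slack 18 9 2] k.

Lemma in_cone_aux_point (U : R) k :
  1 <= U <= 11/10 -> in_cone (tri_vertices U) (aux_point _ k).
Proof.
by move=> U_bounds; case: k => [|[|[|[|k]]]]; rewrite /aux_point /= ?nth_nil;
   apply: in_cone_tri_vertices; nra.
Qed.

(** * The core matrix *)

Definition core n : 'M[R]_(3 * n, 4) :=
  \matrix_(i < 3 * n) if (i < n)%nat then interval_point (node R n i) (node R n i.+2)
                      else aux_point R (i - n).

Lemma row_core_interval n i : (i < n)%nat ->
  exists j, row j (core n) = interval_point (node R n i) (node R n i.+2).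
Proof.
move=> lt_in; have lt_i : (i < 3 * n)%nat by lia.
by exists (Ordinal lt_i); rewrite rowK lt_in.
Qed.

Lemma row_core_aux n k : (3 <= n)%nat -> (k < 5)%nat ->
  exists j, row j (core n) = aux_point R k.
Proof.
move=> n3 k5; have lt_k : (n + k < 3 * n)%nat by lia.
by exists (Ordinal lt_k); rewrite rowK ltnNge leq_addr addKn.
Qed.

Lemma in_plane_core n i : in_plane (row i (core n)).
Proof.
rewrite rowK; case: ifP => _; first exact: slack_plane.
by rewrite /aux_point; case: (i - n)%nat => [|[|[|[|k]]]] /=;
   rewrite ?nth_nil; apply: slack_plane.
Qed.

Lemma in_cone_core_row n c (i : 'I_(3 * n)) : (c < n)%nat -> i != c :> nat ->
  in_cone (tri_vertices (node R n c.+1)) (row i (core n)).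
Proof.
move=> lt_cn nic; have n0 : (0 < n)%nat by lia.
have U_bounds : 1 <= node R n c.+1 <= 11/10 by apply: node_inner_bounds.
rewrite rowK; case: ifP => [lt_in|_]; last exact: in_cone_aux_point.
have lo_bounds := node_bounds R n i; have hi_bounds := node_bounds R n i.+2.
have hi_ge1 : 1 <= node R n i.+2.
  apply: le_trans (node_le R n0 (isT : (1 <= i.+2)%nat)).
  by case/andP: (@node_inner_bounds R n 1 n0).
apply: in_cone_interval_point => //; first by case/andP: hi_bounds => _ ->; rewrite hi_ge1.
exact: double_step_outside (node_le R n0) nic.
Qed.

Lemma core_ge0 n : (2 <= n)%nat -> nonneg_mx (core n).
Proof.
move=> n2 i j; pose c := ((i : nat) == 0%nat) : nat.
have lt_cn : (c < n)%nat by rewrite /c; case: eqP; lia.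
have nic : i != c :> nat by rewrite /c; case: (nat_of_ord i) => [|[]].
have [u u0 iE] := in_cone_core_row lt_cn nic.
rewrite (_ : core n i j = row i (core n) 0 j); last by rewrite [RHS]mxE.
rewrite iE; apply: mulmx_ge0 => //; apply: tri_vertices_ge0.
by have /andP[] := @node_inner_bounds R n c.+1 lt_cn.
Qed.

Lemma nnfact_core_setC1 n (c : 'I_(3 * n)) : (c < n)%nat ->
  nnfact (rows_submx (core n) [set~ c]) 3.
Proof.
move=> lt_cn; apply: (@nnfact_in_cone _ _ _ _ (tri_vertices (node R n c.+1))).
  by apply: tri_vertices_ge0; have /andP[] := @node_inner_bounds R n c.+1 lt_cn.
move=> k; rewrite /rows_submx row_rowsub; apply: in_cone_core_row => //.
by have := enum_valP k; rewrite !inE.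
Qed.

Lemma mxrank_core n : (3 <= n)%nat -> (3 <= \rank (core n))%nat.
Proof.
move=> n3; have [i0 E0] := @row_core_aux n 0 n3 isT.
have [i1 E1] := @row_core_aux n 1 n3 isT; have [i2 E2] := @row_core_aux n 4 n3 isT.
pose B : 'M[R]_(3, 4) := \matrix_k nth (aux_point R 4) [:: aux_point R 0; aux_point R 1] k.
have Bfree : row_free B.
  apply/inj_row_free => v vB0.
  have vB j : \sum_k v 0 k * B k j = 0.
    by have /rowP/(_ j) := vB0; rewrite mxE => ->; rewrite mxE.
  have := vB 0; have := vB 1; have := vB 2; rewrite !sum_ord3 !mxE /= => vz vy vx.
  apply/rowP => k; rewrite mxE.
  have [v0 v1 v2] : [/\ v 0 0 = 0, v 0 1 = 0 & v 0 2 = 0] by split; lra.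
  by case: k => [[|[|[|k]]] k3] //; [rewrite -v0 | rewrite -v1 | rewrite -v2];
     congr (v _ _); apply: val_inj.
rewrite -[leqLHS](eqP Bfree); apply: mxrankS; apply/row_subP => k.
by rewrite rowK; case: k => [[|[|[|k]]] ?] //=;
   [rewrite -E0 | rewrite -E1 | rewrite -E2]; apply: row_sub.
Qed.

Lemma no_inscribed_triangle n (W : 'M[R]_(3, 4)) s : (0 < n)%nat ->
  nonneg_mx W -> (forall k, in_plane (row k W)) ->
  (forall k : 'I_3, W k (s + k%:R) = 0) ->
  (forall k, (k < 5)%nat -> in_cone W (aux_point R k)) ->
  (forall i, (i < n)%nat -> in_cone W (interval_point (node R n i) (node R n i.+2))) ->
  False.
Proof.
move=> n0 W0 Wplane Ws Waux Winterval.
have [||k|a [b [c [a01 b01 c01 inT]]]] := @inscribed_in_tri (colsub (+%R s) W).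
- by move=> k j; rewrite mxE.
- move=> k; have -> : row k (colsub (+%R s) W) = colsub (+%R s) (row k W).
    by apply/rowP => j; rewrite !mxE.
  exact: in_plane_rot.
- by rewrite mxE.
have T x y z w (p := rot s [:: x; y; z; w]) : in_cone W (slack x y z) -> x + z = y + w ->
    in_tri a b c p`_0 p`_1 p`_2.
  move=> + plane; have pE : p = rot s [:: x; y; z; x + z - y] by rewrite plane addrC addKr.
  by move=> /(in_cone_colsub (+%R s))/inT; rewrite slack_rot pE !mxE.
have TL := T 2 9 18 11 (Waux 2%nat isT) ltac:(lra).
have TR := T 18 9 2 11 (Waux 3%nat isT) ltac:(lra).
have TB := T 10 1 10 19 (Waux 4%nat isT) ltac:(lra).
have T111 := T 1 1 1 1 (Waux 0%nat isT) ltac:(lra).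
have T311 := T 3 1 1 3 (Waux 1%nat isT) ltac:(lra).
case: s {Ws inT} T TL TR TB T111 T311 => [[|[|[|[|s]]]] s4] // T TL TR TB T111 T311.
- apply: (no_tri_missing_top n0 a01 b01 c01) T111 T311 TL TR TB _ => i A B lt_in.
  by apply: T (Winterval i lt_in) (esym (subrKC _ _)).
- exact: no_tri_missing_left a01 b01 c01 TL TR TB.
- exact: no_tri_missing_bottom a01 b01 c01 TL TR TB.
- exact: no_tri_missing_right a01 b01 c01 TL TR TB.
Qed.

Lemma nnfact_core_geq n k : (3 <= n)%nat -> nnfact (core n) k -> (4 <= k)%nat.
Proof.
move=> n3 Nk; have k3 := leq_trans (mxrank_core n3) (mxrank_le_nnfact Nk).
rewrite ltn_neqAle k3 andbT; apply/eqP => kE; rewrite -{}kE in Nk.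
have rN : \rank (core n) = 3%nat.
  by apply/eqP; rewrite eqn_leq mxrank_core // mxrank_le_nnfact.
have [W [s [W0 WN NW Ws]]] := nnfact3_inscribed rN Nk.
apply: (@no_inscribed_triangle n W s) => //; first by lia.
- exact: in_plane_submx (@in_plane_core n) WN.
- by move=> l /(row_core_aux n3)[i <-].
- by move=> l /row_core_interval[i <-].
Qed.

Lemma ord_prod_section m r a : m = (r * a)%nat ->
  exists (e : 'I_m -> 'I_r * 'I_a) (e' : 'I_r * 'I_a -> 'I_m), cancel e' e.
Proof.
move=> mE; have cardE : #|{: 'I_r * 'I_a}| = m by rewrite card_prod !card_ord.
exists (fun i => enum_val (cast_ord (esym cardE) i)), (fun t => cast_ord cardE (enum_rank t)).
by move=> t; rewrite cast_ordK enum_rankK.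
Qed.

Lemma card_ord_ltn m n : (n <= m)%nat -> #|[set c : 'I_m | (c < n)%nat]| = n.
Proof.
move=> le_nm; rewrite -sum1dep_card -(big_ord_widen m (fun=> 1%nat)) //.
by rewrite sum1_card card_ord.
Qed.

Lemma exists_notin_image (T T' : finType) (f : T -> T') (S : {set T}) (B : {set T'}) :
  (#|S| < #|B|)%nat -> exists2 c, c \in B & forall i, i \in S -> f i != c.
Proof.
move=> ltSB; have /subsetPn[c cB cS] : ~~ (B \subset f @: S).
  apply: contraL ltSB => /subset_leq_card BS; rewrite -leqNgt.
  exact: leq_trans BS (leq_imset_card _ _).
by exists c => // i iS; apply: contraNneq cS => <-; apply: imset_f.
Qed.

Local Close Scope ring_scope.

Theorem mainTheorem2 (r n : nat) (hn : leq 2 n) :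
  exists M : 'M[R]_(3 * r * n, 3 * r * n),
    nonneg_mx M /\
    (forall k, nnrank M k -> leq (4 * r) k) /\
    (forall S : {set 'I_(3 * r * n)}, #|S| < n ->
       forall k, nnrank (rows_submx M S) k -> leq k (3 * r)).
Proof.
have [n3|n2] := leqP 3 n; last first.
  exists (scalar_mx (GRing.one _)); split; first exact: scalar_mx1_ge0.
  split=> [k [/mxrank_le_nnfact]|S ltSn k [_ kmin]]; first by rewrite mxrank1; nia.
  have kS : k <= #|S| by apply/kmin/nnfact_nrows => i j; rewrite mxE; apply: scalar_mx1_ge0.
  by have := max_card S; rewrite card_ord; nia.
have [|e [e' e'K]] := @ord_prod_section (3 * r * n) r (3 * n); first by lia.
have le_4_3n : 4 <= 3 * n by lia.
(* [inord] maps every [j >= 4] to [0]: copies of the first column pad each block. *)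
pose g j := ((e j).1, inord (e j).2 : 'I_4).
exists (block_diag (core n) e g); split; first exact/block_diag_ge0/core_ge0.
split=> [k [Mk _]|S ltSn k [_ kmin]].
  pose g' (t : 'I_r * 'I_4) := e' (t.1, widen_ord le_4_3n t.2).
  have g'K : cancel g' g by move=> [b j]; rewrite /g e'K /= inord_val.
  by apply: (nnfact_block_diag_geq (d := 4) e'K g'K _ Mk) => l; apply: nnfact_core_geq.
have [|c] := @exists_notin_image _ _ (fun i => (e i).2) S [set c : 'I_(3 * n) | c < n].
  by rewrite card_ord_ltn //; lia.
rewrite inE => lt_cn cS; apply: kmin.
apply: nnfact_rows_block_diag (nnfact_core_setC1 lt_cn).
by move=> i /cS; rewrite !inE.
Qed.
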